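(* Let $\mathbb{A}$ be a finite nonempty alphabet. For each language $L\subseteq \mathbb{A}^*$, $c(L)<+\infty$ if and only if $p_L(n)=O(n^\alpha)$ for some real $\alpha \geq 0$. Likewise, for each infinite word $x\in \mathbb{A}^{\mathbb{N}}$, $c(x)<+\infty$ if and only if $p_x(n)=O(n^\alpha)$ for some real $\alpha\ge 0$.
   Context: $\mathbb{A}^*$ is the set of finite words over $\mathbb{A}$; a language is a subset of $\mathbb{A}^*$. For a language $L$, $p_L(n)$ is the number of words of length $n$ in $L$. For an infinite word $x$, $\mathrm{Fac}(x)$ is the set of all finite blocks of consecutive letters of $x$, including the empty word, and $p_x(n)=p_{\mathrm{Fac}(x)}(n)$. $S^k$ denotes the set of all concatenations of $k$ elements of $S$. For real $\alpha\ge 0$, $\mathcal{L}(\alpha)$ is the collection of languages $S$ over some finite nonempty alphabet with $p_S(n)=O(n^\alpha)$. Define $d_\alpha(L)=\inf\{k\ge 1 : L\subseteq S^k \text{ for some } S\in\mathcal{L}(\alpha)\}$ and the cost $c(L)=\inf\{\alpha\in[0,+\infty) : d_\alpha(L)<+\infty\}$, with $\inf\emptyset=+\infty$; put $c(x)=c(\mathrm{Fac}(x))$. *)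

(* Defs.v *)
From mathcomp Require Import all_boot all_order all_algebra finmap.
From mathcomp Require Import all_classical all_reals all_analysis.
Set Implicit Arguments.
Unset Strict Implicit.
Unset Printing Implicit Defensive.
Import Order.TTheory GRing.Theory Num.Theory.
Import numFieldNormedType.Exports.
Local Open Scope classical_set_scope.
Local Open Scope ring_scope.

(* Letters are drawn from an arbitrary universe U and an alphabet is a finite
   nonempty subset of U; thus languages over different alphabets live in the
   same type and an inclusion L `<=` S ^ k between them makes sense. *)

Definition word_over (U : choiceType) (A : {fset U}) (w : seq U) : Prop :=
  {subset w <= A}.

Definition language_over (U : choiceType) (A : {fset U}) (L : set (seq U)) :
  Prop := forall w, L w -> word_over A w.

(* fset_set is the empty set on infinite arguments, but a language over a
   finite alphabet has only finitely many words of each length. *)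
Definition complexity (U : choiceType) (L : set (seq U)) (n : nat) : nat :=
  #|` fset_set [set w | L w /\ size w = n] |%fset.

Definition poly_growth (R : realType) (alpha : R) (p : nat -> nat) : Prop :=
  (fun n : nat => (p n)%:R : R) =O_\oo (fun n : nat => n%:R `^ alpha).

Definition factors (U : choiceType) (x : nat -> U) : set (seq U) :=
  [set w | exists i n : nat, w = mkseq (fun j => x (i + j)%N) n].

Definition lang_pow (U : choiceType) (S : set (seq U)) (k : nat) :
    set (seq U) :=
  [set w | exists ws : k.-tuple (seq U),
     (forall v, v \in ws -> S v) /\ w = flatten ws].

Definition poly_languages (R : realType) (U : choiceType) (alpha : R) :
    set (set (seq U)) :=
  [set S | (exists B : {fset U}, B != fset0 /\ language_over B S) /\
           poly_growth alpha (complexity S)].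

Definition cover_degree (R : realType) (U : choiceType) (alpha : R)
    (L : set (seq U)) : \bar R :=
  ereal_inf [set (k%:R)%:E | k in
    [set k : nat | (1 <= k)%N /\
       exists2 S, poly_languages alpha S & L `<=` lang_pow S k]].

Definition cost (R : realType) (U : choiceType) (L : set (seq U)) : \bar R :=
  ereal_inf [set alpha%:E | alpha in
    [set alpha : R | 0 <= alpha /\ (cover_degree alpha L < +oo)%E]].

Definition word_cost (R : realType) (U : choiceType) (x : nat -> U) : \bar R :=
  cost R (factors x).

Definition word_complexity (U : choiceType) (x : nat -> U) : nat -> nat :=
  complexity (factors x).

(* Main.v *)
Require Import Defs.
From mathcomp Require Import all_boot all_order all_algebra finmap.
From mathcomp Require Import all_classical all_reals all_analysis.
Import Order.TTheory GRing.Theory Num.Theory.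
Local Open Scope classical_set_scope.
Local Open Scope ring_scope.

(** If p_L(n) = O(n^alpha), then S = L with k = 1 shows that L has cover degree
    1 at alpha, hence finite cost ([poly_growth_cost]).

    Conversely, finite cost gives an inclusion of L in S^k with p_S(n) =
    O(n^alpha).  A word of L of length n is a concatenation of k words of S, and
    each of them has length at most n.  If p_S(m) <= C (m+1)^d for all m, then S
    has at most (n+1) C (n+1)^d words of length at most n, so
    p_L(n) <= (C (n+1)^(d+1))^k, which is polynomial in n ([cost_poly_growth]).

    Real exponents and asymptotic bounds only matter up to enlarging the
    exponent, so the counting is done with the everywhere valid natural number
    bound p n <= C (n+1)^d; [poly_growthP] makes the translation.  The claim on
    infinite words is the claim on their languages of factors. *)

(** A growth hypothesis says nothing about small arguments and its exponent is
    real; enlarging the constant and rounding the exponent up gives a bound for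
    all n.  The shift to n + 1 keeps the bound positive at n = 0. *)
Lemma poly_growthP (R : realType) (p : nat -> nat) :
  (exists2 alpha : R, 0 <= alpha & poly_growth alpha p) <->
  (exists C d : nat, forall n, (p n <= C * n.+1 ^ d)%N).
Proof.
split=> [[alpha alpha0 /eqO_exP[k k0 [N _ pk]]]|[C [d pC]]].
  pose c := (Num.truncn k).+1; pose d := (Num.truncn alpha).+1.
  (* The sum bounds p below the threshold N, where the hypothesis is silent. *)
  exists (c + \sum_(i < N) p i)%N, d => n.
  rewrite mulnDl; case: (ltnP n N) => [nN|Nn].
    apply: leq_trans (leq_addl _ _).
    apply: leq_trans (leq_pmulr _ _); last by rewrite expn_gt0.
    by rewrite (bigD1 (Ordinal nN)) //= leq_addr.
  apply: leq_trans (leq_addr _ _).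
  have := pk n Nn; rewrite /= normr_nat (ger0_norm (powR_ge0 _ _)) => pn.
  rewrite -(ler_nat R) natrM natrX; apply: (le_trans pn).
  apply: ler_pM; [exact: ltW|exact: powR_ge0|by apply/ltW/truncnS_gt|].
  apply: (@le_trans _ _ (n.+1%:R `^ alpha)).
    by apply: ge0_ler_powR; rewrite ?nnegrE ?ler_nat.
  rewrite -powR_mulrn//; apply: ler_powR; first by rewrite ler1n.
  by apply/ltW/truncnS_gt.
exists d%:R => //; apply/eqO_exP; exists (C.+1 * 2 ^ d)%:R.
  by rewrite ltr0n muln_gt0 expn_gt0.
exists 1%N => // n /= n1.
rewrite normr_nat (ger0_norm (powR_ge0 _ _)) powR_mulrn// -natrX -natrM ler_nat.
apply: (leq_trans (pC n)); rewrite -mulnA -expnMn leq_mul//.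
by case: d {pC} => // d; rewrite leq_exp2r// mul2n -addnn -addn1 leq_add2l.
Qed.

Section Words.
Variable U : choiceType.
Implicit Types (A : {fset U}) (L S : set (seq U)) (s : seq (seq U)).

Lemma complexity_le_size L n s :
  (forall w, L w -> size w = n -> w \in s) -> (complexity L n <= size s)%N.
Proof.
move=> Ls; have fin : finite_set [set w | L w /\ size w = n].
  apply: (@sub_finite_set _ _ [set` s]); last exact: finite_seq.
  by move=> w [Lw sw]; exact: Ls.
rewrite /complexity; apply: uniq_leq_size; first exact: fset_uniq.
move=> w; rewrite in_fset_set// inE => -[]; exact: Ls.
Qed.

Definition concats s k : seq (seq U) :=
  iter k (fun t => [seq v ++ w | v <- s, w <- t]) [:: [::]].

Lemma size_concats s k : size (concats s k) = (size s ^ k)%N.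
Proof. by elim: k => //= k IH; rewrite size_allpairs IH expnS. Qed.

Lemma mem_concats s ws : {subset ws <= s} -> flatten ws \in concats s (size ws).
Proof.
elim: ws => [|v ws IH] wss //=; apply: allpairs_f.
  by apply: wss; exact: mem_head.
by apply: IH => w wws; apply: wss; rewrite inE wws orbT.
Qed.

(** The words of length n over A are concatenations of n one-letter words.
    Finiteness matters because [complexity] is 0 by convention on an infinite
    set of words, so it only counts the words of a given length once this is
    known. *)
Lemma finite_words_of_length A L n :
  language_over A L -> finite_set [set w | L w /\ size w = n].
Proof.
move=> LA; pose letters := [seq [:: a] | a <- enum_fset A].
apply: (@sub_finite_set _ _ [set` concats letters n]); last exact: finite_seq.
move=> w [/LA wA <-] /=; rewrite -{1}[w]flatten_seq1 -(size_map (cons^~ [::])).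
by apply: mem_concats => _ /mapP[a /wA aA ->]; exact: map_f.
Qed.

Definition words_upto S n : seq (seq U) :=
  flatten [seq enum_fset (fset_set [set w | S w /\ size w = m])
          | m <- iota 0 n.+1].

Lemma mem_words_upto A S n w :
  language_over A S -> S w -> (size w <= n)%N -> w \in words_upto S n.
Proof.
move=> SA Sw wn; apply/flatten_mapP; exists (size w).
  by rewrite mem_iota.
by rewrite in_fset_set ?inE//; exact: finite_words_of_length SA.
Qed.

Lemma size_words_upto S n M :
  (forall m, (m <= n)%N -> (complexity S m <= M)%N) ->
  (size (words_upto S n) <= M * n.+1)%N.
Proof.
move=> SM; rewrite size_flatten /shape -map_comp sumnE big_map.
rewrite (@leq_trans (\sum_(m <- iota 0 n.+1) M)) //.
  rewrite !big_seq; apply: leq_sum => m; rewrite mem_iota => mn; exact: SM.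
by rewrite big_const_seq count_predT size_iota iter_addn_0.
Qed.

Lemma size_le_flatten s v : v \in s -> (size v <= size (flatten s))%N.
Proof.
elim: s => //= u s IH; rewrite inE size_cat => /predU1P[->|/IH vs].
  exact: leq_addr.
exact: leq_trans vs (leq_addl _ _).
Qed.

(** A factor of a concatenation is no longer than the whole, so in counting the
    words of length n of S^k only the words of S of length at most n matter.
    Concatenations are counted with their decompositions, an overcount that
    leaves the bound polynomial in n for fixed k. *)
Lemma complexity_lang_pow A S L k n M :
    language_over A S -> L `<=` lang_pow S k ->
    (forall m, (m <= n)%N -> (complexity S m <= M)%N) ->
  (complexity L n <= (M * n.+1) ^ k)%N.
Proof.
move=> SA LS SM.
apply: (@leq_trans (size (concats (words_upto S n) k))); last first.
  rewrite size_concats; case: k {LS} => // k.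
  by rewrite leq_exp2r// size_words_upto.
apply: complexity_le_size => w /LS[ws [wsS ->]] szw.
rewrite -[X in concats _ X](size_tuple ws); apply: mem_concats => v vws.
apply: mem_words_upto SA (wsS v vws) _.
by rewrite -szw size_le_flatten.
Qed.

Lemma poly_growth_cost (R : realType) A L (alpha : R) :
    A != fset0 -> language_over A L -> 0 <= alpha ->
    poly_growth alpha (complexity L) ->
  (cost R L < +oo)%E.
Proof.
move=> A0 LA alpha0 Lalpha.
have cd : (cover_degree alpha L < +oo)%E.
  apply: (@le_lt_trans _ _ (1%:R)%:E); last exact: ltry.
  apply: ereal_inf_lbound; exists 1%N => //; split=> //; exists L.
    by split=> //; exists A.
  move=> w Lw; exists [tuple w]; rewrite /= cats0; split=> // v.
  by rewrite inE => /eqP ->.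
apply: (@le_lt_trans _ _ alpha%:E); last exact: ltry.
by apply: ereal_inf_lbound; exists alpha.
Qed.

Lemma cost_poly_growth (R : realType) L :
    (cost R L < +oo)%E ->
  exists2 alpha : R, 0 <= alpha & poly_growth alpha (complexity L).
Proof.
move=> /ereal_inf_lt[_ [alpha [alpha0 + _] _]].
move=> /ereal_inf_lt[_ [k [_ [S [[B [_ SB]] Salpha] LS]] _] _].
have /poly_growthP[C [d SC]] :
    exists2 a : R, 0 <= a & poly_growth a (complexity S) by exists alpha.
apply/poly_growthP; exists (C ^ k)%N, (d.+1 * k)%N => n.
rewrite expnM -expnMn expnSr mulnA.
apply: complexity_lang_pow SB LS _ => m mn.
apply: (leq_trans (SC m)); rewrite leq_mul//.
by case: d {SC} => // d; rewrite leq_exp2r.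
Qed.

End Words.

Theorem corollary3p9 (R : realType) (U : choiceType) (A : {fset U})
    (hA : A != fset0) :
  (forall L : set (seq U), language_over A L ->
     ((cost R L < +oo)%E <->
      exists2 alpha : R, 0 <= alpha & poly_growth alpha (complexity L))) /\
  (forall x : nat -> U, (forall n, x n \in A) ->
     ((word_cost R x < +oo)%E <->
      exists2 alpha : R, 0 <= alpha & poly_growth alpha (word_complexity x))).
Proof.
have main L : language_over A L -> (cost R L < +oo)%E <->
    exists2 alpha : R, 0 <= alpha & poly_growth alpha (complexity L).
  move=> LA; split=> [|[alpha alpha0 Lalpha]]; first exact: cost_poly_growth.
  exact: poly_growth_cost hA LA alpha0 Lalpha.
split=> // x xA; apply: main => _ [i [n ->]] _ /mapP[j _ ->]; exact: xA.
Qed.
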